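(* For every $m\in\mathbb{N}$ there exists a class of functions $\mathcal{F}_m\subset L^1([0,\infty))$ such that $$w(\Lambda_1|\mathcal{F}_1)\ge 1.38\qquad\text{and}\qquad \liminf_{m\to\infty} w(\Lambda_m|\mathcal{F}_m)\ge 1.37.$$
   Context: $\mathbb{N}=\{1,2,3,\dots\}$; $|\cdot|$ applied to a set denotes Lebesgue measure. For $m\in\mathbb{N}$ the operator $\Lambda_m$ acts on $f\in L^1([0,\infty))$ by $$\Lambda_m f(t)=\frac{1+m}{t^{1+m/2}}\int_0^t f(s)s^{m/2}\,ds-f(t),\qquad t>0 .$$ For an operator $T$ acting on $L^1([0,\infty))$ and a class $\mathcal{F}\subset L^1([0,\infty))$, the restricted weak-type $(1,1)$ constant is $$w(T|\mathcal{F})=\sup\Bigl\{\frac{|\{t\in[0,\infty):|Tf(t)|\ge 1\}|}{\|f\|_{L^1([0,\infty))}}: f\in\mathcal{F},\ \|f\|_{L^1([0,\infty))}\ne 0\Bigr\}.$$ *)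

(* Defs.v *)
From HB Require Import structures.
From mathcomp Require Import all_boot all_order all_algebra.
From mathcomp Require Import all_classical all_reals all_analysis.

Set Implicit Arguments.
Unset Strict Implicit.
Unset Printing Implicit Defensive.

Import Order.TTheory GRing.Theory Num.Theory.
Import numFieldNormedType.Exports.

Local Open Scope classical_set_scope.
Local Open Scope ring_scope.

(* Elements of L^1([0,oo)) are represented by functions on the whole line;
   membership, L1norm and the values of Lambda on [0,oo) only depend on their
   restriction to [0,oo). *)
Definition L1 (R : realType) : set (R -> R) :=
  [set f | (@lebesgue_measure R).-integrable `[0, +oo[ (EFin \o f)].

Definition L1norm (R : realType) (f : R -> R) : \bar R :=
  (\int[@lebesgue_measure R]_(t in `[0%R, +oo[) `|f t|%:E)%E.

(* Since x^-1 = 0 at x = 0, Lambda m f 0 = - f 0; the point 0 is Lebesgue-null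
   and plays no role below. *)
Definition Lambda (R : realType) (m : nat) (f : R -> R) (t : R) : R :=
  (1 + m%:R) / t `^ (1 + m%:R / 2)
    * (\int[@lebesgue_measure R]_(s in `[0, t]) (f s * s `^ (m%:R / 2)))
  - f t.

Definition weak_ratio (R : realType) (T : (R -> R) -> (R -> R))
    (f : R -> R) : \bar R :=
  (lebesgue_measure [set t : R | (0 <= t)%R /\ (1 <= `|T f t|)%R]
     / L1norm f)%E.

Definition weak_const (R : realType) (T : (R -> R) -> (R -> R))
    (F : set (R -> R)) : \bar R :=
  ereal_sup [set weak_ratio T f | f in [set f | F f /\ L1norm f != 0%E]].

(* Main.v *)
(* Write p = 1 + m/2, K = (1 + m)/p and A for the averaging part of Lambda_m,
   so that Lambda_m f = A - f. If f oscillates rapidly between 0 and 2 with mean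
   1/K, then A stays close to 1, so |Lambda_m f| is about 1 everywhere while f
   costs only 1/K per unit length; this gives the ratio K, which increases from
   4/3 (m = 1) to 2. The oscillation is taken geometric: if A(x) = 1, put f = 2c
   on ]x, yx] and f = 0 on ]yx, rho x], with c = 101/100 and with y, rho such
   that A stays in [1, 2c - 1] and A(rho x) = 1 again. For m = 1 the ratio 4/3 is
   improved by continuing with the constant -9/25 on ]x, 6/5 x] after the last
   period: there A + 9/25 >= 64/100 + 9/25 = 1, at a cost well below 1 per unit
   length. *)

Require Import Defs.
From mathcomp Require Import all_boot all_order all_algebra.
From mathcomp Require Import all_classical all_reals all_analysis.
From mathcomp Require Import measurable_realfun lra.
Set Implicit Arguments.
Unset Strict Implicit.
Unset Printing Implicit Defensive.

Import Order.TTheory GRing.Theory Num.Theory.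
Import numFieldNormedType.Exports.
Local Open Scope classical_set_scope.
Local Open Scope ring_scope.

(** * Integrals of powers over intervals away from 0 *)

Section power_integral.
Context {R : realType}.
Notation mu := (@lebesgue_measure R).
Implicit Types (k x y : R).

Lemma within_continuous_powR k x y : 0 < x ->
  {within `[x, y], continuous (powR (R:=R))^~ k}.
Proof.
move=> x0; apply/continuous_in_subspaceT => z; rewrite inE /= in_itv/= => /andP[xz _].
apply: differentiable_continuous; apply/derivable1_diffP.
apply: derivable_powR.
by rewrite in_itv/= andbT (lt_le_trans x0).
Qed.

Lemma integrable_powR k x y : 0 < x ->
  mu.-integrable `[x, y] (EFin \o (powR (R:=R))^~ k).
Proof.
move=> x0; apply: continuous_compact_integrable; first exact: segment_compact.
exact: within_continuous_powR.
Qed.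

Lemma Rintegral_powR k x y : 0 < 1 + k -> 0 < x -> x < y ->
  \int[mu]_(s in `]x, y]) s `^ k = (y `^ (1 + k) - x `^ (1 + k)) / (1 + k).
Proof.
move=> k0 x0 xy.
have xyk : mu.-integrable `]x, y] (EFin \o (powR (R:=R))^~ k).
  apply: integrableS (integrable_powR k y x0) => //.
  exact: subset_itv_oc_cc.
rewrite Rintegral_itv_obnd_cbnd//.
pose F (z : R) := z `^ (1 + k) / (1 + k).
have pos z : x <= z -> z \in `]0, +oo[ by move=> xz; rewrite in_itv/= andbT (lt_le_trans x0).
have dF z : x <= z -> derivable F z 1.
  by move=> xz; apply: derivableM => //; apply: derivable_powR; exact: pos.
have cF z : x <= z -> {for z, continuous F}.
  by move=> xz; apply: differentiable_continuous; apply/derivable1_diffP; exact: dF.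
rewrite /Rintegral (@continuous_FTC2 _ _ F)//.
- by rewrite /F -EFinB /= mulrBl.
- exact: within_continuous_powR.
- split.
  + by move=> z; rewrite in_itv/= => /andP[/ltW xz _]; exact: dF.
  + exact: cvg_at_right_filter (cF x (lexx _)).
  + exact: cvg_at_left_filter (cF y (ltW xy)).
- move=> z; rewrite in_itv/= => /andP[/ltW xz _].
  rewrite /F derive1Mr; last by apply: derivable_powR; exact: pos.
  rewrite powR_derive1 ?pos//= addrAC subrr add0r mulrAC divff ?mul1r//.
  exact: lt0r_neq0.
Qed.

End power_integral.

(** * Step functions built block by block, with their norm and weighted integral *)

Section blocks.
Context {R : realType}.
Notation mu := (@lebesgue_measure R).
Implicit Types (f : R -> R) (k h x y t D V : R).

(** The invariant of the construction: [D] is the cost so far and [V] the complete weighted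
    integral. For k = m/2 the averaging part beyond [x] is (1 + m) V / t^p, so A(x) = 1 exactly when
    V = x^p / (1 + m). *)
Definition supported_upto k f x D V :=
  [/\ mu.-integrable setT (EFin \o f),
      mu.-integrable setT (EFin \o (fun s => f s * s `^ k)),
      (forall t, x < t -> f t = 0),
      L1norm f = D%:E &
      forall t, x <= t -> \int[mu]_(s in `[0, t]) (f s * s `^ k) = V].

Lemma supported_upto_L1 k f x D V : supported_upto k f x D V -> L1 f.
Proof. by move=> [f1 _ _ _ _]; exact: integrableS f1. Qed.

Definition add_block f h x y : R -> R := f \+ (cst h \_ `]x, y]).

Lemma add_block_le f h x y t : t <= x -> add_block f h x y t = f t.
Proof.
move=> tx; rewrite /add_block/= patchE memNset ?addr0//=.
by rewrite in_itv/= ltNge tx.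
Qed.

Lemma add_block_in f h x y t : f t = 0 -> x < t <= y -> add_block f h x y t = h.
Proof.
by move=> ft xty; rewrite /add_block/= patchE mem_set ?ft ?add0r//= in_itv.
Qed.

Lemma add_block_gt f h x y t : y < t -> add_block f h x y t = f t.
Proof.
move=> tx; rewrite /add_block/= patchE memNset ?addr0//=.
by rewrite in_itv/= [t <= y]leNgt tx andbF.
Qed.

Lemma integrable_block k h x y : 0 < x ->
  mu.-integrable setT (EFin \o (fun s => (cst h \_ `]x, y]) s * s `^ k)).
Proof.
move=> x0.
have -> : EFin \o (fun s => (cst h \_ `]x, y]) s * s `^ k) =
   (EFin \o (fun s => h * s `^ k)) \_ `]x, y].
  by apply/funext => s /=; rewrite !patchE; case: ifPn => //=; rewrite mul0r.
apply/(integrable_mkcond _ _).1 => //.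
apply: (@integrableZl _ _ _ mu `]x, y] _ h (EFin \o (powR (R:=R))^~ k)) => //.
apply: integrableS (integrable_powR k y x0) => //.
exact: subset_itv_oc_cc.
Qed.

Lemma integrable_add_block k f h x y : 0 < x ->
  mu.-integrable setT (EFin \o (fun s => f s * s `^ k)) ->
  mu.-integrable setT (EFin \o (fun s => add_block f h x y s * s `^ k)).
Proof.
move=> x0 fi.
have -> : EFin \o (fun s => add_block f h x y s * s `^ k) =
    (EFin \o (fun s => f s * s `^ k)) \+
    (EFin \o (fun s => (cst h \_ `]x, y]) s * s `^ k)).
  by apply/funext => s /=; rewrite mulrDl.
by apply: integrableD => //; exact: integrable_block.
Qed.

Lemma Rintegral_block k h x y t : 0 < 1 + k -> 0 < x -> x < y -> y <= t ->
  \int[mu]_(s in `[0, t]) ((cst h \_ `]x, y]) s * s `^ k) =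
  h * ((y `^ (1 + k) - x `^ (1 + k)) / (1 + k)).
Proof.
move=> k0 x0 xy yt.
rewrite -Rintegral_powR// -RintegralZl//; last first.
  apply: integrableS (integrable_powR k y x0) => //.
  exact: subset_itv_oc_cc.
rewrite [LHS]Rintegral_mkcond [RHS]Rintegral_mkcond.
apply: eq_Rintegral => s _; rewrite !patchE/= !mem_setE !in_itv/=.
have [/andP[xs sy]|] := boolP (x < s <= y).
  by rewrite (ltW (lt_trans x0 xs)) (le_trans sy yt).
by rewrite mul0r if_same.
Qed.

Lemma Rintegral_add_block_le k f h x y t : t <= x ->
  \int[mu]_(s in `[0, t]) (add_block f h x y s * s `^ k) =
  \int[mu]_(s in `[0, t]) (f s * s `^ k).
Proof.
move=> tx; apply: eq_Rintegral => s.
rewrite mem_setE in_itv/= => /andP[_ st].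
by rewrite add_block_le// (le_trans st).
Qed.

Lemma Rintegral_add_block_in k f h x y t D V : 0 < 1 + k -> 0 < x ->
  supported_upto k f x D V -> x < t <= y ->
  \int[mu]_(s in `[0, t]) (add_block f h x y s * s `^ k) =
  V + h * ((t `^ (1 + k) - x `^ (1 + k)) / (1 + k)).
Proof.
move=> k0 x0 [_ fi _ _ fV] /andP[xt ty].
(* Inside [0, t] the block ]x, y] coincides with ]x, t], which is a complete block. *)
transitivity (\int[mu]_(s in `[0, t])
    (f s * s `^ k + (cst h \_ `]x, t]) s * s `^ k)).
  apply: eq_Rintegral => s; rewrite mem_setE in_itv/= => /andP[_ st].
  rewrite /add_block/= mulrDl !patchE !mem_setE !in_itv/= st.
  by rewrite (le_trans st ty).
rewrite RintegralD//.
- by rewrite Rintegral_block// fV// ltW.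
- exact: integrableS fi.
- by apply: (@integrableS _ _ _ mu setT) => //; exact: integrable_block.
Qed.

(** The norms add because the supports are disjoint: [f] vanishes beyond [x], where the block
    begins. *)
Lemma supported_upto_add_block k f h x y D V : 0 < 1 + k -> 0 < x -> x < y ->
  supported_upto k f x D V ->
  supported_upto k (add_block f h x y) y (D + `|h| * (y - x))
    (V + h * ((y `^ (1 + k) - x `^ (1 + k)) / (1 + k))).
Proof.
move=> k0 x0 xy fs; have [f1 fi f0 fD fV] := fs.
(* Exponent 0 turns the weighted block into the block itself. *)
have b1 : mu.-integrable setT (EFin \o (cst h \_ `]x, y])).
  have := integrable_block 0 h y x0.
  by apply: eq_integrable => // s _ /=; rewrite powRr0 mulr1.
split.
- have -> : EFin \o add_block f h x y = (EFin \o f) \+ (EFin \o (cst h \_ `]x, y])).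
    by apply/funext => s.
  exact: integrableD.
- exact: integrable_add_block.
- by move=> t yt; rewrite add_block_gt// f0// (lt_trans xy).
- rewrite EFinD -fD /L1norm.
  have -> : (`|h| * (y - x))%:E = (\int[mu]_(t in `[0%R, +oo[) `|(cst h \_ `]x, y]) t|%:E)%E.
    rewrite EFinM. 
    transitivity (\int[mu]_(t in `]x, y]) cst `|h|%:E t)%E.
      rewrite integral_cst//= lebesgue_measure_itv/= lte_fin xy.
      by rewrite -EFinB.
    rewrite [LHS]integral_mkcond [RHS]integral_mkcond; apply: eq_integral => s _.
    rewrite !patchE !mem_setE !in_itv/= andbT.
    have [/andP[xs sy]|] := boolP (x < s <= y).
      by rewrite (ltW (lt_trans x0 xs)).
    by rewrite normr0 if_same.
  rewrite -ge0_integralD//.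
  + apply: eq_integral => s _.
    rewrite -EFinD; congr EFin.
    have [sx|xs] := leP s x.
      rewrite add_block_le// patchE memNset ?normr0 ?addr0//=.
      by rewrite in_itv/= ltNge sx.
    by rewrite /add_block/= f0// add0r normr0 add0r.
  + apply/measurable_EFinP; apply: measurableT_comp => //.
    apply: (@measurable_funS _ _ _ _ setT) => //.
    by apply/measurable_EFinP; exact: measurable_int f1.
  + apply/measurable_EFinP; apply: measurableT_comp => //.
    apply: (@measurable_funS _ _ _ _ setT) => //.
    by apply/measurable_EFinP; exact: measurable_int b1.
- move=> t yt; have xt := le_trans (ltW xy) yt.
  transitivity (\int[mu]_(s in `[0, t])
      (f s * s `^ k + (cst h \_ `]x, y]) s * s `^ k)).
    by apply: eq_Rintegral => s _; rewrite -mulrDl.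
  rewrite RintegralD//.
  + by rewrite Rintegral_block// fV.
  + exact: integrableS fi.
  + by apply: (@integrableS _ _ _ mu setT) => //; exact: integrable_block.
Qed.

Lemma supported_upto_widen k f x z D V : x <= z ->
  supported_upto k f x D V -> supported_upto k f z D V.
Proof.
move=> xz [f1 fi f0 fD fV]; split=> // t zt; last exact: fV (le_trans xz zt).
exact: f0 (le_lt_trans xz zt).
Qed.

(** The construction starts at 1, since blocks are only added at positive points. *)
Lemma supported_upto_zero k : supported_upto k (cst 0) 1 0 0.
Proof.
have w0 : (fun s : R => cst 0 s * s `^ k) = cst 0.
  by apply/funext => s /=; rewrite mul0r.
split=> //.
- exact: integrable0.
- rewrite w0; exact: integrable0.
- rewrite /L1norm; under eq_integral do rewrite normr0.
  exact: integral0.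
- by move=> t _; rewrite w0 /Rintegral integral0.
Qed.

End blocks.

(** * Lower bounds for weak-type constants and lower limits; a tangent inequality *)

Section weak_type.
Context {R : realType}.
Notation mu := (@lebesgue_measure R).
Implicit Types (f : R -> R) (a b r x y t D : R).

(** [lebesgue_measure] is an outer measure on arbitrary sets, hence monotone there; this spares
    proving that the level set of [T f] is measurable. *)
Lemma le_lebesgue_measure (A B : set R) : A `<=` B -> (mu A <= mu B)%E.
Proof.
move=> AB; rewrite /lebesgue_measure /lebesgue_stieltjes_measure /measure_extension.
exact: le_mu_ext.
Qed.

(** A single test function bounds the supremum from below: its level set contains ]a, b]. *)
Lemma weak_const_L1_ge (T : (R -> R) -> R -> R) f a b r D :
  L1 f -> L1norm f = D%:E -> 0 < D -> 0 <= a -> a <= b ->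
  (forall t, a < t <= b -> 1 <= `|T f t|) -> r * D <= b - a ->
  (r%:E <= weak_const T (@L1 R))%E.
Proof.
move=> f1 fD D0 a0 ab fT rD.
apply: le_trans (ereal_sup_ubound _); last first.
  exists f => //; split=> //; rewrite fD.
  by rewrite gt_eqF // lte_fin.
rewrite /weak_ratio fD inver gt_eqF// lee_pdivlMr// -EFinM.
apply: (@le_trans _ _ (mu `]a, b])).
  rewrite lebesgue_measure_itv/= lte_fin; case: ifPn => [_|].
    by rewrite -EFinB lee_fin.
  rewrite -leNgt => ba; rewrite lee_fin (le_trans rD)// subr_le0//.
apply: le_lebesgue_measure => t /=; rewrite in_itv/= => tab; split; last exact: fT.
by case/andP: tab => /ltW /(le_trans a0).
Qed.

(** The lower limit is the supremum of the tail infima, and the tail from [N] on already has infimum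
    at least [l]. *)
Lemma le_limn_einf (u : (\bar R)^nat) (l : \bar R) (N : nat) :
  (forall n, (N <= n)%N -> (l <= u n)%E) -> (l <= limn_einf u)%E.
Proof.
move=> lu; rewrite limn_einf_lim (cvg_lim _ (@cvg_einfs_sup _ u))//.
apply: le_trans (ereal_sup_ubound _); last by exists N.
by apply: le_ereal_inf_tmp => _ [n /= Nn <-]; exact: lu.
Qed.

(** Young's inequality for the product y * 1 with exponent p and its conjugate; equivalently, the
    convex y^p lies above its tangent at 1. *)
Lemma le_tangent_powR (p y : R) : 1 < p -> 0 <= y -> y <= 1 + (y `^ p - 1) / p.
Proof.
move=> p1 y0; have p0 : 0 < p by rewrite (lt_trans ltr01).
have pV1 : p^-1 < 1 by rewrite invf_lt1.
have q0 : 0 < (1 - p^-1)^-1 by rewrite invr_gt0 subr_gt0.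
have pq : p^-1 + ((1 - p^-1)^-1)^-1 = 1 by rewrite invrK addrC subrK.
have := conjugate_powR y0 ler01 p0 q0 pq.
rewrite powR1 mulr1 invrK; lra.
Qed.

End weak_type.

(** * Choice of the period *)

Section parameters.
Context {R : realType}.
Implicit Types (K p y rho : R).

Lemma exists_natM_gt (a b : R) : 0 <= a -> 0 < b -> exists n : nat, a < n%:R * b.
Proof.
move=> a0 b0; exists (Num.bound (a / b)); rewrite -ltr_pdivrMr//.
by apply: archi_boundP; rewrite divr_ge0// ltW.
Qed.

(** [Y] and [P] stand for y^p and rho^p, with c = 101/100. The equation for [P] restores A = 1 at
    the end of a period, P <= (2c - 1) Y keeps A <= 2c - 1 at the end of the block, and P / K will
    bound the cost per unit length, close to the ideal 1 / K. *)
Lemma period_powers K : 1 <= K -> exists Y P : R,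
  [/\ 1 < Y, Y <= P, P = 1 + 2 * (101 / 100) * K * (Y - 1),
      P <= (2 * (101 / 100) - 1) * Y & P / K <= K^-1 + 41 / 1000].
Proof.
move=> K1; have K0 : 0 < K by rewrite (lt_le_trans ltr01).
have d1 : 1 <= 202 / 100 * (K - 1) + 1 by lra.
have d0 := lt_le_trans ltr01 d1.
(* This e = Y - 1 turns P <= (2c - 1) Y into an equality. Since K >= 1, it is at most 2/100, so P /
   K = 1 / K + 2ce exceeds 1 / K by at most 0.0404. *)
have [e eE] : exists e : R, e * (202 / 100 * (K - 1) + 1) = 2 / 100.
  by exists (2 / 100 / (202 / 100 * (K - 1) + 1)); rewrite mulfVK ?gt_eqF.
have e0 : 0 < e by rewrite -(pmulr_lgt0 _ d0) eE; lra.
have e2 : e <= 2 / 100 by rewrite -eE ler_peMr// ltW.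
have eK : e <= K * e by rewrite ler_peMl// ltW.
exists (1 + e), (1 + 2 * (101 / 100) * K * e); split.
- lra.
- lra.
- lra.
- lra.
rewrite mulrDl mul1r lerD2l.
have -> : 2 * (101 / 100) * K * e / K = 2 * (101 / 100) * e.
  by rewrite mulrAC mulfK// gt_eqF.
lra.
Qed.

Lemma period_parameters K p : 0 < p -> 1 <= K -> exists y rho,
  [/\ 1 < y, y <= rho, rho `^ p = 1 + 2 * (101 / 100) * K * (y `^ p - 1),
      rho `^ p <= (2 * (101 / 100) - 1) * y `^ p &
      rho `^ p / K <= K^-1 + 41 / 1000].
Proof.
move=> p0 /period_powers[Y [P [Y1 YP PE PY PK]]].
have Y0 := ltW (lt_trans ltr01 Y1); have P0 := le_trans Y0 YP.
have rootK (z : R) : 0 <= z -> (z `^ p^-1) `^ p = z.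
  by move=> z0; rewrite -powRrM mulVf ?gt_eqF// powRr1.
exists (Y `^ p^-1), (P `^ p^-1); rewrite !rootK//; split=> //.
  have : 1 `^ p^-1 < Y `^ p^-1.
    by apply: gt0_ltr_powR => //; rewrite ?invr_gt0 ?nnegrE.
  by rewrite powR1.
by apply: ge0_ler_powR; rewrite ?invr_ge0// ltW.
Qed.

End parameters.

(** * The operator on block functions and the periodic construction *)

Section Lambda_blocks.
Context {R : realType}.
Variable m : nat.
Notation k := (m%:R / 2 : R).
Notation p := (1 + k).
Notation w := (1 + m%:R : R).
Implicit Types (f : R -> R) (c h x y t D V Y P rho : R).

Lemma half_nat_ge0 : 0 <= k. Proof. by rewrite divr_ge0. Qed.

Lemma half_nat1_gt0 : 0 < p.
Proof. by rewrite ltr_wpDr ?half_nat_ge0. Qed.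

Lemma nat1_gt0 : 0 < w. Proof. by rewrite ltr_wpDr. Qed.

Lemma Lambda_add_block_le f h x y t : t <= x ->
  Lambda m (add_block f h x y) t = Lambda m f t.
Proof. by move=> tx; rewrite /Lambda Rintegral_add_block_le// add_block_le. Qed.

Lemma Lambda_add_block_in f h x y t D V : 0 < x -> supported_upto k f x D V ->
  x < t <= y ->
  Lambda m (add_block f h x y) t =
  w / t `^ p * (V + h * ((t `^ p - x `^ p) / p)) - h.
Proof.
move=> x0 fs xty; rewrite /Lambda (Rintegral_add_block_in _ half_nat1_gt0 x0 fs xty).
rewrite add_block_in//; case: fs => _ _ f0 _ _.
by apply: f0; case/andP: xty.
Qed.

Lemma Lambda_gt f x t D V : supported_upto k f x D V -> x < t ->
  Lambda m f t = w / t `^ p * V.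
Proof.
by move=> [_ _ f0 _ fV] xt; rewrite /Lambda f0// fV ?subr0// ltW.
Qed.

Let lew_powR x y : 0 <= x -> x <= y -> x `^ p <= y `^ p.
Proof.
move=> x0 xy; apply: ge0_ler_powR => //.
by rewrite nnegrE (le_trans x0).
Qed.

(** On ]x, yx] the new function is 2c and A <= 2c - 1, so Lambda_m <= -1. On ]yx, rho x] it vanishes
    and A(t) = (rho x / t)^p >= 1. At the end A(rho x) = 1, so another period can follow. *)
Lemma period_step f c x y rho D : 0 < x -> 1 <= c -> 1 <= w / p -> 1 < y ->
  y <= rho -> rho `^ p = 1 + 2 * c * (w / p) * (y `^ p - 1) ->
  rho `^ p <= (2 * c - 1) * y `^ p ->
  supported_upto k f x D (x `^ p / w) ->
  (forall t, x < t <= rho * x ->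
    1 <= `|Lambda m (add_block f (2 * c) x (y * x)) t|) /\
  supported_upto k (add_block f (2 * c) x (y * x)) (rho * x)
    (D + 2 * c * (y - 1) * x) ((rho * x) `^ p / w).
Proof.
move=> x0 c1 kappa1 y1 yrho rhoE rho_le fs.
have p0 := half_nat1_gt0; have w0 := nat1_gt0.
have y0 : 0 < y by exact: lt_trans y1.
have xy : x < y * x by rewrite ltr_pMl.
have X0 : 0 < x `^ p by rewrite powR_gt0.
have wK z : w * (z / w) = z by rewrite mulrCA divff ?mulr1 ?gt_eqF.
(* With z = x^p and Z = t^p this computes t^p A(t) for t in the block. *)
have wV z Z : w * (z / w + 2 * c * ((Z - z) / p)) = z + 2 * c * (w / p) * (Z - z).
  rewrite mulrDr wK; lra.
have gs := supported_upto_add_block (2 * c) p0 x0 xy fs.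
have VE : x `^ p / w + 2 * c * (((y * x) `^ p - x `^ p) / p) = (rho * x) `^ p / w.
  apply: (mulfI (lt0r_neq0 w0)); rewrite wV wK.
  rewrite !powRM ?(ltW x0) ?(ltW y0) ?(le_trans (ltW y0))// rhoE; lra.
have DE : D + `|2 * c| * (y * x - x) = D + 2 * c * (y - 1) * x.
  rewrite ger0_norm; last lra.
  lra.
rewrite VE DE in gs; split.
- move=> t /andP[xt tr].
  have t0 : 0 < t by exact: lt_trans xt.
  have T0 : 0 < t `^ p by rewrite powR_gt0.
  have [ty|yt] := leP t (y * x).
  + rewrite (Lambda_add_block_in _ x0 fs) ?xt//.
    suff : w / t `^ p * (x `^ p / w + 2 * c * ((t `^ p - x `^ p) / p)) <= 2 * c - 1.
      move=> H; rewrite ler0_norm; lra.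
    rewrite mulrAC ler_pdivrMr// wV.
    have XT : x `^ p <= t `^ p by apply: lew_powR; exact: ltW.
    have TY : t `^ p <= y `^ p * x `^ p.
      by rewrite -powRM ?(ltW x0) ?(ltW y0)//; apply: lew_powR; rewrite ?(ltW t0).
    move: (w / p) (y `^ p) (t `^ p) (x `^ p) (rho `^ p) kappa1 rhoE rho_le X0 XT TY.
    move=> K Y T X P K1 PE PY X0' XT TY; rewrite PE in PY.
    (* The goal is linear in T, with its worst case T = YX at the end of the block: [H1] reduces to
       that case and [H2] is that case. *)
    have H1 : 0 <= (2 * c * (K - 1) + 1) * (Y * X - T).
      apply: mulr_ge0; last lra.
      by apply: addr_ge0 => //; apply: mulr_ge0; lra.
    have H2 : 0 <= X * ((2 * c - 1) * Y - (1 + 2 * c * K * (Y - 1))).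
      by apply: mulr_ge0; lra.
    lra.
  + rewrite (Lambda_gt gs yt).
    rewrite mulrAC mulrCA divff ?gt_eqF// mulr1.
      rewrite ger0_norm; last by rewrite divr_ge0 ?powR_ge0.
      by rewrite ler_pdivlMr// mul1r; apply: lew_powR; rewrite ?(ltW t0).
- by apply: supported_upto_widen gs; rewrite ler_pM2r.
Qed.

(** A period costs 2c(y - 1)x on a length (rho - 1)x, so the cost per unit length is at most rho^p /
    K. The tangent inequality at y gives 2cK(y - 1) <= (rho^p - 1)/p, and at 1/rho it gives (rho^p -
    1)/p <= rho^p (rho - 1). *)
Lemma period_cost c y rho : (0 < m)%N -> 0 <= c -> 0 < y -> 1 <= rho ->
  rho `^ p = 1 + 2 * c * (w / p) * (y `^ p - 1) ->
  2 * c * (y - 1) <= rho `^ p / (w / p) * (rho - 1).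
Proof.
move=> m0 c0 y0 rho1 rhoE.
have p0 := half_nat1_gt0; have w0 := nat1_gt0.
have p1 : 1 < p by rewrite ltrDl divr_gt0// ltr0n.
have K0 : 0 < w / p by rewrite divr_gt0.
have rho0 : 0 < rho by rewrite (lt_le_trans ltr01).
have P0 : 0 < rho `^ p by rewrite powR_gt0.
have yY := le_tangent_powR p1 (ltW y0).
have rhoV0 : 0 <= rho^-1 by rewrite invr_ge0 ltW.
have P1 : 1 <= rho `^ p by have := lew_powR ler01 rho1; rewrite powR1.
have := le_tangent_powR p1 rhoV0.
have -> : rho^-1 `^ p = (rho `^ p)^-1.
  by rewrite -(powR_inv1 (ltW rho0)) powRAC powR_inv1// powR_ge0.
move: yY rhoE P0 P1; move: (rho `^ p) (y `^ p) (w / p) K0 => P Y K K0 yY rhoE P0 P1.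
rewrite -(ler_pM2l rho0) mulfV ?gt_eqF// => rhoP.
have step : 2 * c * K * (y - 1) <= (P - 1) / p.
  rewrite rhoE addrAC subrr add0r -[leRHS]mulrA ler_wpM2l//.
    by rewrite !mulr_ge0// ltW.
  by rewrite lerBlDl.
rewrite [leRHS]mulrAC ler_pdivlMr//.
have PV : P * P^-1 = 1 by rewrite mulfV ?gt_eqF.
have H1 : 0 <= P * (rho - 1 - rho * (1 - P^-1) / p).
  by rewrite mulr_ge0 ?(ltW P0)//; lra.
have H2 : 0 <= (rho - 1) * ((P - 1) / p).
  by rewrite mulr_ge0 ?divr_ge0 ?subr_ge0// ltW.
have H3 : rho * (P * P^-1) / p = rho / p by rewrite PV mulr1.
lra.
Qed.

(** A constant on ]1, 2], chosen so that A(2) = 1. Its cost is (p/w) 2^p / (2^p - 1), and 2^p >=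
    2. *)
Lemma start_block : (0 < m)%N -> exists f D,
  [/\ supported_upto k f 2 D (2 `^ p / w), 0 < D & D <= p / w * 2].
Proof.
move=> m0.
have p0 := half_nat1_gt0; have w0 := nat1_gt0.
have p1 : 1 <= p by rewrite lerDl half_nat_ge0.
have P2 : 2 <= 2 `^ p :> R by apply: le1r_powR => //; rewrite ler1n.
pose a := 2 `^ p / w * (p / (2 `^ p - 1)) : R.
have a0 : 0 < a by rewrite !mulr_gt0 ?invr_gt0//; lra.
have := supported_upto_add_block a p0 ltr01 (ltr1n _ 2) (supported_upto_zero k).
rewrite !add0r gtr0_norm// powR1.
have -> : a * ((2 `^ p - 1) / p) = 2 `^ p / w.
  rewrite /a -mulrA [X in _ * X]mulrA mulfVK ?mulfV ?mulr1//; lra.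
exists (add_block (cst 0) a 1 2), (a * (2 - 1)); split => //.
  by rewrite mulr_gt0// subr_gt0 ltr1n.
have -> : a * (2 - 1) = p / w * (2 `^ p / (2 `^ p - 1)) by rewrite /a; lra.
rewrite ler_pM2l ?divr_gt0// ler_pdivrMr; lra.
Qed.

(** Induction on the number of periods: each multiplies x by rho, which adds at least rho - 1
    because x >= 1, and [period_cost] preserves the bound on the cost. Only the initial stretch up
    to 2 is given up. *)
Lemma many_periods c y rho n : (0 < m)%N -> 1 <= c -> 1 <= w / p -> 1 < y ->
  y <= rho -> rho `^ p = 1 + 2 * c * (w / p) * (y `^ p - 1) ->
  rho `^ p <= (2 * c - 1) * y `^ p ->
  exists f x D,
    [/\ 2 + n%:R * (rho - 1) <= x,
        supported_upto k f x D (x `^ p / w), 0 < D,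
        D <= rho `^ p / (w / p) * x &
        forall t, 2 < t <= x -> 1 <= `|Lambda m f t|].
Proof.
move=> m0 c1 K1 y1 yrho rhoE rho_le.
have rho1 : 1 <= rho by exact: le_trans (ltW y1) yrho.
have P1 : 1 <= rho `^ p by have := lew_powR ler01 rho1; rewrite powR1.
elim: n => [|n [f [x [D [xn fs D0 Dx fL]]]]].
  have [f [D [fs D0 D2]]] := start_block m0.
  exists f, 2, D; split=> //; first by rewrite mul0r addr0.
    rewrite (le_trans D2)// ler_wpM2r// invf_div.
    by rewrite ler_peMl// divr_ge0// ltW ?half_nat1_gt0 ?nat1_gt0.
  by move=> t /andP[t2 /(lt_le_trans t2)]; rewrite ltxx.
have nrho : 0 <= n%:R * (rho - 1) by rewrite mulr_ge0 ?subr_ge0.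
have x0 : 0 < x by lra.
have [gL gs] := period_step x0 c1 K1 y1 yrho rhoE rho_le fs.
have cost : 2 * c * (y - 1) <= rho `^ p / (w / p) * (rho - 1).
  by apply: period_cost => //; lra.
exists (add_block f (2 * c) x (y * x)), (rho * x), (D + 2 * c * (y - 1) * x).
split => //.
- have : 0 <= (rho - 1) * (x - 1) by rewrite mulr_ge0; lra.
  rewrite -natr1; lra.
- by rewrite ltr_wpDr// !mulr_ge0; lra.
- move: cost; rewrite -(ler_pM2r x0); lra.
- move=> t /andP[t2 tx]; have [tx'|xt] := leP t x.
    by rewrite Lambda_add_block_le// fL// t2.
  by rewrite gL// xt.
Qed.

(** A large [b] makes the stretch up to 2 negligible against [x]; p / w is 1 / K. *)
Lemma long_periodic b : (0 < m)%N -> 0 <= b -> exists f x D,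
    [/\ b <= x,
        supported_upto k f x D (x `^ p / w), 0 < D,
        D <= (p / w + 41 / 1000) * x &
        forall t, 2 < t <= x -> 1 <= `|Lambda m f t|].
Proof.
move=> m0 b0.
have p0 := half_nat1_gt0; have w0 := nat1_gt0.
have K1 : 1 <= w / p.
  by rewrite ler_pdivlMr// mul1r lerD2l ler_pdivrMr// ler_peMr// ler1n.
have [y [rho [y1 yrho rhoE rho_le rhoK]]] := period_parameters p0 K1.
have c1 : 1 <= 101 / 100 :> R by rewrite ler_pdivlMr ?mul1r ?ler_nat.
have rho1 : 0 < rho - 1.
  rewrite subr_gt0; exact: lt_le_trans y1 yrho.
have [n nb] := exists_natM_gt b0 rho1.
have [f [x [D [xn fs D0 Dx fL]]]] := many_periods n m0 c1 K1 y1 yrho rhoE rho_le.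
have bx : b <= x.
  by apply: le_trans (le_trans (ltW nb) _) xn; rewrite lerDr.
exists f, x, D; split=> //; apply: (le_trans Dx).
by rewrite -[p / w]invf_div ler_wpM2r// (le_trans _ bx).
Qed.

End Lambda_blocks.

(** * Numerical bounds for m >= 2 and for m = 1 *)

Lemma weak_const_Lambda_ge (R : realType) (m : nat) : (2 <= m)%N ->
  ((137 / 100)%:E <= weak_const (@Lambda R m) (@L1 R))%E.
Proof.
move=> m2; have m0 : (0 < m)%N by exact: ltnW.
(* From x >= 300 the lost length 2 is at most x/150, and 1.37 (2/3 + 0.041) < 0.97 < 1 - 1/150. *)
have [f [x [D [bx fs D0 Dx fL]]]] := long_periodic m0 (ler0n R 300).
have [_ _ _ fD _] := fs.
rewrite -subr_ge0 in bx.
have p0 := @half_nat1_gt0 R m; have w0 := @nat1_gt0 R m.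
(* p / w decreases in m and equals 2/3 at m = 2. *)
have pw : (1 + m%:R / 2) / (1 + m%:R) <= 2 / 3 :> R.
  have : 2 <= m%:R :> R by rewrite ler_nat.
  rewrite ler_pdivrMr//; move: (m%:R) => M; lra.
have x0 : 0 < x by clear - bx; lra.
have Dx' : D <= (2 / 3 + 41 / 1000) * x.
  by apply: le_trans Dx _; rewrite ler_pM2r// lerD2r.
apply: (weak_const_L1_ge (supported_upto_L1 fs) fD D0 (ler0n R 2) _ fL).
- clear - bx; lra.
- clear - bx Dx'; lra.
Qed.

(** The periods cost at most (3/4 + 0.041)x and the final block 0.36 x/5, in all 0.863x for a length
    1.2x - 2; with x >= 300, 1.38 * 0.863 < 1.191 < 1.2 - 2/300. *)
Lemma weak_const_Lambda1_ge (R : realType) :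
  ((138 / 100)%:E <= weak_const (@Lambda R 1) (@L1 R))%E.
Proof.
have [f [x [D [bx fs D0 Dx fL]]]] := long_periodic (ltn0Sn 0) (ler0n R 300).
rewrite -subr_ge0 in bx.
have p0 := @half_nat1_gt0 R 1; have w0 := @nat1_gt0 R 1.
have x0 : 0 < x by clear - bx; lra.
have xX : x < 6 / 5 * x by clear - x0; lra.
have gs := supported_upto_add_block (- (9 / 25)) p0 x0 xX fs.
have [_ _ _ gD _] := gs.
have p32 : 1 + 1%:R / 2 = 3 / 2 :> R by lra.
have w2 : 1 + 1%:R = 2 :> R by lra.
rewrite p32 w2 in Dx.
have h65 : 0 <= 6 / 5 :> R by lra.
have h0 : - (9 / 25) <= 0 :> R by lra.
rewrite ler0_norm// opprK in gD.
have D'0 : 0 < D + 9 / 25 * (6 / 5 * x - x) by clear - D0 x0; lra.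
have X0 : 0 < x `^ (1 + 1%:R / 2) by rewrite powR_gt0.
(* (6/5)^(3/2) is bounded through its square: (6/5)^3 = 1.728 <= 1.7424 = 1.32^2. *)
have E2 : ((6 / 5 : R) `^ (1 + 1%:R / 2)) ^+ 2 = (6 / 5) ^+ 3.
  rewrite -powR_mulrn ?powR_ge0// -powRrM -powR_mulrn//.
  by congr (_ `^ _); lra.
have E0 := powR_ge0 (6 / 5 : R) (1 + 1%:R / 2).
have E132 : (6 / 5 : R) `^ (1 + 1%:R / 2) <= 132 / 100.
  move: E2 E0; move: (_ `^ _) => E; clear; rewrite !expr2 !exprS expr0; nra.
apply: (@weak_const_L1_ge _ _ _ _ (6 / 5 * x) _ _ (supported_upto_L1 gs) gD D'0
  (ler0n R 2)).
- clear - bx; lra.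
- move=> t /andP[t2 tx]; have [tx'|xt] := leP t x.
    by rewrite Lambda_add_block_le// fL// t2.
  have t0 : 0 < t by exact: lt_trans xt.
  have T0 : 0 < t `^ (1 + 1%:R / 2) by rewrite powR_gt0.
  have XT : x `^ (1 + 1%:R / 2) <= t `^ (1 + 1%:R / 2).
    by apply: ge0_ler_powR; rewrite ?nnegrE ltW.
  have TX : t `^ (1 + 1%:R / 2) <= 132 / 100 * x `^ (1 + 1%:R / 2).
    apply: (@le_trans _ _ ((6 / 5 * x) `^ (1 + 1%:R / 2))).
      by apply: ge0_ler_powR; rewrite ?nnegrE ?(ltW p0) ?(ltW t0) ?mulr_ge0 ?h65 ?(ltW x0).
    by rewrite (powRM _ h65 (ltW x0)) ler_pM2r.
  rewrite (Lambda_add_block_in _ x0 fs); last by rewrite xt.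
  move: X0 T0 XT TX; move: (t `^ _) (x `^ _) => T X X0 T0 XT TX.
  (* Here A = 1.48 X/T - 0.48 and T <= 1.32 X; subtracting the value -9/25 then supplies the missing
     0.36. *)
  have : 64 / 100 <= (1 + 1%:R) / T * (X / (1 + 1%:R) +
      - (9 / 25) * ((T - X) / (1 + 1%:R / 2))).
    rewrite p32 w2 mulrAC ler_pdivlMr//; clear - X0 T0 XT TX; lra.
  move=> L; apply: le_trans (ler_norm _); clear - L; lra.
- clear - bx Dx; lra.
Qed.

Theorem theorem1p1 (R : realType) :
  exists F : nat -> set (R -> R),
    [/\ forall m : nat, (1 <= m)%N -> F m `<=` @L1 R,
        ((138 / 100)%:E <= weak_const (@Lambda R 1) (F 1%N))%E
      & ((137 / 100)%:E <=
          limn_einf (fun m : nat => weak_const (@Lambda R m) (F m)))%E].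
Proof.
(* The whole of L^1 serves as the class for every m; the lower limit is bounded through the terms
   with m >= 2. *)
exists (fun=> @L1 R); split; [by move=> m _ f|exact: weak_const_Lambda1_ge|].
exact: le_limn_einf (@weak_const_Lambda_ge R).
Qed.
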